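(* Let $p,q\in A=\mathbb{R}[x_1,\ldots,x_n]$. Suppose the following conditions are satisfied: (a) $L_{\mathrm{lex}}(p)\notin L_{\mathrm{lex}}(q)A$. (b) The quadratic modules $\mathrm{QM}(q)$ and $\mathrm{QM}(-p)$ are totally stable with respect to the $z$-grading for every $z\in\mathbb{N}^n_1$, and neither $q=0$ nor $p=0$. Then there is no non-negative polynomial $t\in A$ such that $p(y)-t(y)q(y)\geq 0$ for all $y\in\mathbb{R}^n$.
   Context: Let $n\geq 1$ and $A=\mathbb{R}[x_1,\ldots,x_n]$. A polynomial $h\in A$ is non-negative if $h(x)\ge 0$ for all $x\in\mathbb{R}^n$. $L_{\mathrm{lex}}(h)$ denotes the leading term (coefficient times monomial) of $h$ with respect to the lexicographical ordering with $x_1\succ x_2\succ\cdots\succ x_n$, and $L_{\mathrm{lex}}(q)A$ is the ideal generated by $L_{\mathrm{lex}}(q)$. For $f_1,\ldots,f_s\in A$, $\mathrm{QM}(f_1,\ldots,f_s)=\{\sigma_0+\sigma_1f_1+\cdots+\sigma_sf_s:\sigma_0,\ldots,\sigma_s\in\Sigma A^2\}$ is the quadratic module generated by $f_1,\ldots,f_s$, where $\Sigma A^2$ is the set of sums of squares in $A$. For $z\in\mathbb{Z}^n$ the $z$-grading of $A$ is $A=\bigoplus_{d\in\mathbb{Z}}A^{(z)}_d$, where $A^{(z)}_d$ is the span of the monomials $x_1^{\delta_1}\cdots x_n^{\delta_n}$, $\delta\in\mathbb{N}_0^n$, with $\langle z,\delta\rangle=z_1\delta_1+\cdots+z_n\delta_n=d$.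 The degree of a non-zero polynomial with respect to the $z$-grading is the largest $d$ for which its component in $A^{(z)}_d$ is non-zero, and $\deg(0)=-\infty$. A finitely generated quadratic module $M\subseteq A$ is totally stable with respect to the $z$-grading if $\deg(f)\leq\deg(f+g)$ for all $f,g\in M$, where $\deg$ is the degree with respect to the $z$-grading. $\mathbb{N}=\{1,2,3,\ldots\}$ and $\mathbb{N}^n_1=\{z\in\mathbb{N}^n: z_1\geq z_i\text{ for all } i\in\{1,\ldots,n\}\}$. *)

(* Defs.v *)
From HB Require Import structures.
From mathcomp Require Import all_boot all_order all_algebra.
From mathcomp Require Import mpoly.
From mathcomp Require Import reals constructive_ereal.

Set Implicit Arguments.
Unset Strict Implicit.
Unset Printing Implicit Defensive.

Import Order.TTheory GRing.Theory Num.Theory.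

Local Open Scope ring_scope.

(* The monomial order built into mpoly compares total degrees first, so the
   pure lexicographic order (variable 0 the largest) is taken instead from
   tuplelexi.  The value at 0 is the unit monomial. *)
Definition lex_mlead (n : nat) (R : nzRingType) (h : {mpoly R[n]}) : 'X_{1..n} :=
  Multinom (\join_(m <- msupp h) (multinom_val m : n.-tuplelexi nat))%O.

Definition lex_lterm (n : nat) (R : nzRingType) (h : {mpoly R[n]}) : {mpoly R[n]} :=
  h@_(lex_mlead h) *: 'X_[lex_mlead h].

Definition in_principal_ideal (A : comNzRingType) (g f : A) : Prop :=
  exists a : A, f = g * a.

Definition nonneg_poly (n : nat) (R : realType) (h : {mpoly R[n]}) : Prop :=
  forall x : 'I_n -> R, 0 <= h.@[x].

Definition sos (A : comNzRingType) (f : A) : Prop :=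
  exists s : seq A, f = \sum_(a <- s) a ^+ 2.

Definition QM (A : comNzRingType) (fs : seq A) (f : A) : Prop :=
  exists (s0 : A) (s : 'I_(size fs) -> A),
    [/\ sos s0, forall i, sos (s i) &
        f = s0 + \sum_(i < size fs) s i * fs`_i].

Definition zweight (n : nat) (z : 'I_n -> int) (m : 'X_{1..n}) : int :=
  \sum_(i < n) z i * (m i)%:Z.

Definition zcomp (n : nat) (R : nzRingType) (z : 'I_n -> int) (d : int)
    (f : {mpoly R[n]}) : {mpoly R[n]} :=
  \sum_(m <- msupp f | zweight z m == d) f@_m *: 'X_[m].

(* Valued in \bar int so that the degree of 0 is -oo.  See zdegP for the
   description as the largest index of a non-zero component. *)
Definition zdeg (n : nat) (R : nzRingType) (z : 'I_n -> int)
    (f : {mpoly R[n]}) : \bar int :=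
  \big[Order.max/-oo%E]_(m <- msupp f) (zweight z m)%:E%E.

Definition totally_stable (n : nat) (R : nzRingType) (z : 'I_n -> int)
    (M : {mpoly R[n]} -> Prop) : Prop :=
  forall f g : {mpoly R[n]}, M f -> M g -> (zdeg z f <= zdeg z (f + g))%E.

Definition in_N1 (n : nat) (z : 'I_n.+1 -> int) : Prop :=
  forall i, 0 < z i <= z ord0.

Section Checks.
Variables (n : nat) (R : nzRingType).
Implicit Types (f h : {mpoly R[n]}) (z : 'I_n -> int).

Lemma lex_mlead_supp h : h != 0 -> lex_mlead h \in msupp h.
Proof.
rewrite -msupp_eq0 /lex_mlead.
elim: (msupp h) => [//|m [|m' s] IH] _.
  by rewrite big_seq1 inE; apply/eqP/val_inj.
rewrite big_cons in_cons joinEtotal /Order.max.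
case: ifP => _; last by apply/orP; left; apply/eqP/val_inj.
by rewrite IH ?orbT.
Qed.

Lemma lex_mlead_max h m : m \in msupp h ->
  ((multinom_val m : n.-tuplelexi nat)
     <= (multinom_val (lex_mlead h) : n.-tuplelexi nat))%O.
Proof. by move=> hm; apply: (@joins_sup_seq _ _ _ (msupp h) xpredT). Qed.

Lemma zdeg0 z : zdeg z (0 : {mpoly R[n]}) = -oo%E.
Proof. by rewrite /zdeg msupp0 big_nil. Qed.

Lemma zcomp_neq0 z d f :
  reflect (exists2 m, m \in msupp f & zweight z m = d) (zcomp z d f != 0).
Proof.
have E k : (zcomp z d f)@_k = f@_k *+ (zweight z k == d).
  rewrite /zcomp raddf_sum big_mkcond {3}[f]mpolyE raddf_sum -sumrMnl /=.
  apply: eq_bigr => m _; rewrite mcoeffZ mcoeffX.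
  by case: (m =P k) => [->|_]; rewrite ?mulr0 ?mul0rn; case: ifP.
apply: (iffP idP) => [|[m hm hd]].
  rewrite -msupp_eq0; case Es: (msupp _) => [//|k s] _.
  have: k \in msupp (zcomp z d f) by rewrite Es mem_head.
  rewrite mcoeff_msupp E; case: (zweight z k =P d) => [<- hk|_]; last by rewrite eqxx.
  by exists k => //; rewrite mcoeff_msupp.
apply/eqP => /(congr1 (mcoeff m)); rewrite E hd eqxx mcoeff0 => /eqP.
by apply/negP; rewrite -mcoeff_msupp.
Qed.

Lemma zdegP z f : f != 0 ->
  exists d : int, [/\ zdeg z f = d%:E%E, zcomp z d f != 0 &
    forall e : int, zcomp z e f != 0 -> e <= d].
Proof.
rewrite -msupp_eq0 => nz.
have [d [Ed [m hm hd] dmax]] : exists d : int, [/\ zdeg z f = d%:E%E,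
    exists2 m, m \in msupp f & zweight z m = d &
    forall m, m \in msupp f -> zweight z m <= d].
  rewrite /zdeg; elim: (msupp f) nz => [//|m [|m' s] IH] _.
    exists (zweight z m); split; last by move=> k; rewrite inE => /eqP->.
      by rewrite big_seq1.
    by exists m; rewrite ?mem_head.
  have [d [Ed [k hk kd] dmax]] := IH isT.
  exists (Num.max (zweight z m) d); split.
  - by rewrite big_cons Ed EFin_max.
  - case: (leP (zweight z m) d) => _; last by exists m; rewrite ?mem_head.
    by exists k; rewrite // inE hk orbT.
  - move=> l; rewrite inE => /orP[/eqP->|/dmax hl]; rewrite le_max ?lexx //.
    by rewrite hl orbT.
exists d; split=> //; first by apply/zcomp_neq0; exists m.
by move=> e /zcomp_neq0[k hk <-]; apply: dmax.
Qed.

End Checks.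

(* Main.v *)
Require Import Defs.
From mathcomp Require Import all_boot all_order all_algebra.
From mathcomp Require Import mpoly.
From mathcomp Require Import reals constructive_ereal.
From mathcomp Require Import polyrcf.
From mathcomp Require Import zify.

Set Implicit Arguments.
Unset Strict Implicit.

Import Order.TTheory GRing.Theory Num.Theory.
Local Open Scope ring_scope.

(** Leading terms alone decide the question.  Only finitely many monomials
    occur, so the lexicographic order on them is realised by one weight vector
    w in N^n_1 whose entries are decreasing powers of a large base B: the weight
    of a monomial is then the number whose base-B digits are its exponents
    ([digit_weight_lex]).

    Total stability for w says something about the lexicographic leading term
    c X^m of f: if c <= 0 and all exponents of m are even, then - c X^m is a
    square in QM(f), and adding f to it cancels its only term, which lowers the
    degree.  So c X^m must be positive at some point without zero coordinates
    ([stable_top_term]).  This applies to q and to - p.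

    Conversely, a polynomial that is non-negative everywhere is non-negative
    along the curve x |-> (s_i x^(w_i)), where it is a univariate polynomial
    whose leading coefficient is the value at s of its leading term
    ([curve_poly_top]).  Now let t >= 0 and p - t q >= 0, and compare the
    weights of the leading terms of p and t q.  If p is heavier or t = 0, the
    leading term of p is non-negative, which stability of QM(-p) forbids.  If t q is
    heavier, its leading term is non-positive while that of t is positive, so
    the leading term of q is non-positive, which stability of QM(q) forbids.
    If the weights agree, then so do the monomials, and the leading term of q
    divides that of p, against the first hypothesis. *)

(** * Weights realising the lexicographic order *)

Definition digit_weight (B n : nat) (i : 'I_n.+1) : nat := (B ^ (n - i))%N.

Definition nweight (n : nat) (w : 'I_n -> nat) (m : 'X_{1..n}) : nat :=
  (\sum_(i < n) w i * m i)%N.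

Lemma zweightE (n : nat) (w : 'I_n -> nat) (m : 'X_{1..n}) :
  zweight (fun i => (w i)%:Z) m = (nweight w m)%:Z.
Proof.
rewrite /zweight /nweight (big_morph Posz PoszD (erefl 0)).
by apply: eq_bigr => i _; rewrite PoszM.
Qed.

Lemma nweightD (n : nat) (w : 'I_n -> nat) (m1 m2 : 'X_{1..n}) :
  nweight w (m1 + m2)%MM = (nweight w m1 + nweight w m2)%N.
Proof.
by rewrite /nweight -big_split /=; apply: eq_bigr => i _; rewrite mnmDE mulnDr.
Qed.

Lemma digit_weight_N1 (B n : nat) : (0 < B)%N ->
  in_N1 (fun i : 'I_n.+1 => (digit_weight B i)%:Z).
Proof.
move=> B_gt0 i; apply/andP; split; first by rewrite ltz_nat expn_gt0 B_gt0.
by rewrite lez_nat leq_pexp2l // leq_sub2l.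
Qed.

Lemma numeral_lt (B n : nat) (a : 'I_n -> nat) :
  (forall i, a i < B)%N -> (\sum_(i < n) B ^ (n.-1 - i) * a i < B ^ n)%N.
Proof.
elim: n a => [|n IH] a a_lt; first by rewrite big_ord0.
rewrite big_ord_recl /= subn0 expnS.
have := IH (fun i => a (lift ord0 i)) (fun i => a_lt _).
have -> : (\sum_(i < n) B ^ (n - bump 0 i) * a (lift ord0 i)
  = \sum_(i < n) B ^ (n.-1 - i) * a (lift ord0 i))%N.
  by apply: eq_bigr => i _; congr (_ ^ _ * _)%N; rewrite /bump /=; lia.
have := leq_mul (leqnn (B ^ n)) (a_lt ord0).
by rewrite mulnS [(B * _)%N]mulnC; lia.
Qed.

(** Comparing two numerals by their first different digit: one more unit there
    outweighs everything that the later digits can contribute. *)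
Lemma numeral_lex (B n : nat) (a b : 'I_n.+1 -> nat) (k : 'I_n.+1) :
  (forall i, a i < B)%N -> (forall i : 'I_n.+1, i < k -> a i = b i)%N ->
  (a k < b k)%N ->
  (\sum_(i < n.+1) B ^ (n - i) * a i < \sum_(i < n.+1) B ^ (n - i) * b i)%N.
Proof.
elim: n a b k => [|n IH] a b k a_lt eq_ab lt_ab.
  by rewrite !big_ord1 !subnn !mul1n; rewrite (ord1 k) in lt_ab.
have shift c : (\sum_(i < n.+1) B ^ (n.+1 - bump 0 i) * c (lift ord0 i)
  = \sum_(i < n.+1) B ^ (n - i) * c (lift ord0 i))%N.
  by apply: eq_bigr => i _.
rewrite [ltnLHS]big_ord_recl [ltnRHS]big_ord_recl /= !subn0 !shift.
case: (unliftP ord0 k) => [j|] def_k; last first.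
  have := numeral_lt (fun i => a_lt (lift ord0 i)); rewrite /=.
  have := leq_mul (leqnn (B ^ n.+1)) lt_ab; rewrite def_k mulnS; lia.
rewrite (eq_ab ord0) ?def_k // ltn_add2l.
apply: (IH _ _ j) => [//|i lt_ij|]; last by rewrite -def_k.
by apply: eq_ab; rewrite def_k.
Qed.

Lemma digit_weight_lex (B n : nat) (m1 m2 : 'X_{1..n.+1}) :
  (forall i, m1 i < B)%N ->
  ((multinom_val m1 : n.+1.-tuplelexi nat)
     < (multinom_val m2 : n.+1.-tuplelexi nat))%O ->
  (nweight (@digit_weight B n) m1 < nweight (@digit_weight B n) m2)%N.
Proof.
move=> m1_lt /ltxi_tuplePlt[k eq_k lt_k].
by apply: (numeral_lex (k := k)).
Qed.

Lemma digit_weight_inj (B n : nat) (m1 m2 : 'X_{1..n.+1}) :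
  (forall i, m1 i < B)%N -> (forall i, m2 i < B)%N ->
  nweight (@digit_weight B n) m1 = nweight (@digit_weight B n) m2 -> m1 = m2.
Proof.
move=> lt1 lt2 eq_w.
have := @digit_weight_lex _ _ m1 m2 lt1; have := @digit_weight_lex _ _ m2 m1 lt2.
rewrite eq_w !ltnn => nlt21 nlt12; apply: val_inj.
case: (ltgtP (multinom_val m1 : n.+1.-tuplelexi nat)
             (multinom_val m2 : n.+1.-tuplelexi nat)) => //.
  by move/nlt12.
by move/nlt21.
Qed.

(** * Polynomials with a single monomial of largest weight *)

(** The weight is required to isolate [m], so that the leading form of [f] is a
    single term. *)
Definition top_mon (n : nat) (R : nzRingType) (w : 'I_n -> nat)
    (m : 'X_{1..n}) (f : {mpoly R[n]}) : Prop :=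
  m \in msupp f /\
  forall k, k \in msupp f -> k != m -> (nweight w k < nweight w m)%N.

Lemma top_monN (n : nat) (R : nzRingType) (w : 'I_n -> nat) m
    (f : {mpoly R[n]}) : top_mon w m f -> top_mon w m (- f).
Proof.
by case=> m_f max_m; split=> [|k]; rewrite (perm_mem (msuppN f)) //; apply: max_m.
Qed.

Lemma mnm_lt_msize (n : nat) (R : nzRingType) (f : {mpoly R[n]}) m i :
  m \in msupp f -> (m i < msize f)%N.
Proof.
move/msize_mdeg_lt; apply: leq_ltn_trans.
by rewrite mdegE (bigD1 i) //= leq_addr.
Qed.

Lemma top_mon_lex (n : nat) (R : nzRingType) (B : nat) (f : {mpoly R[n.+1]}) :
  f != 0 -> (msize f <= B)%N ->
  top_mon (@digit_weight B n) (lex_mlead f) f.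
Proof.
move=> f_neq0 le_fB; split=> [|k k_f neq_k]; first exact: lex_mlead_supp.
apply: digit_weight_lex => [i|].
  exact: leq_trans (mnm_lt_msize i k_f) le_fB.
rewrite lt_neqAle lex_mlead_max // andbT.
by apply: contraNneq neq_k => /val_inj ->.
Qed.

Lemma msupp_sub_lead (n : nat) (R : nzRingType) (f : {mpoly R[n]}) m k :
  (k \in msupp (f - f@_m *: 'X_[m])) = (k \in msupp f) && (k != m).
Proof.
rewrite !mcoeff_msupp mcoeffB mcoeffZ mcoeffX.
case: (eqVneq k m) => [->|neq_k]; first by rewrite ?eqxx mulr1 subrr ?eqxx andbF.
by rewrite mulr0 subr0 andbT.
Qed.

(** * Leading terms along monomial curves *)

(** [h] restricted to the curve whose i-th coordinate is [s i * x ^+ w i], as a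
    polynomial in x; on it, weight becomes degree. *)
Definition curve_poly (n : nat) (R : comNzRingType) (w : 'I_n -> nat)
    (s : 'I_n -> R) (h : {mpoly R[n]}) : {poly R} :=
  mmap polyC (fun i => s i *: 'X^(w i)) h.

Section Curve.
Variables (n : nat) (R : idomainType) (w : 'I_n -> nat) (s : 'I_n -> R).
Implicit Types (h : {mpoly R[n]}) (m : 'X_{1..n}).
Local Notation curve := (curve_poly w s).

Lemma curve_polyB h1 h2 : curve (h1 - h2) = curve h1 - curve h2.
Proof. exact: mmapB. Qed.

Lemma curve_polyZX c m :
  curve (c *: 'X_[m]) = (c * 'X_[m].@[s]) *: 'X^(nweight w m).
Proof.
rewrite /curve_poly mmapZ mmapX mevalX mul_polyC -scalerA; congr (_ *: _).
rewrite /mmap1 /nweight -prodrXr -scaler_prod; apply: eq_bigr => i _.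
by rewrite exprZn exprM.
Qed.

Lemma size_curve_poly h (d : nat) :
  (forall k, k \in msupp h -> (nweight w k < d)%N) -> (size (curve h) <= d)%N.
Proof.
move=> lt_d; rewrite {1}[h]mpolyE /curve_poly raddf_sum /=.
rewrite big_seq; apply: (leq_trans (size_sum _ _ _)).
apply/bigmax_leqP_seq => k k_h _.
rewrite -[mmap _ _ _]/(curve _) curve_polyZX.
by rewrite (leq_trans (size_scale_leq _ _)) // size_polyXn lt_d.
Qed.

Lemma horner_curve_poly h x :
  (curve h).[x] = h.@[fun i => s i * x ^+ w i].
Proof.
rewrite /curve_poly mevalE /mmap horner_sum; apply: eq_bigr => m _.
rewrite hornerM hornerC /mmap1 horner_prod; congr (_ * _).
by apply: eq_bigr => i _; rewrite horner_exp hornerZ hornerXn.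
Qed.

(** Without a zero coordinate of [s] the top term does not vanish on the curve,
    and every other term of [h] has smaller degree there. *)
Lemma curve_poly_top m h :
  top_mon w m h -> (forall i, s i != 0) ->
  size (curve h) = (nweight w m).+1 /\
  lead_coef (curve h) = h@_m * 'X_[m].@[s].
Proof.
move=> [m_h max_m] s_neq0.
have c_neq0 : h@_m * 'X_[m].@[s] != 0.
  rewrite mulf_neq0 -?mcoeff_msupp // mevalX.
  by apply/prodf_neq0 => i _; rewrite expf_neq0.
have -> : curve h = curve (h@_m *: 'X_[m]) + curve (h - h@_m *: 'X_[m]).
  by rewrite curve_polyB addrC subrK.
have sz_top : size (curve (h@_m *: 'X_[m])) = (nweight w m).+1.
  by rewrite curve_polyZX size_scale // size_polyXn.
have lt_rest : (size (curve (h - h@_m *: 'X_[m])) < (nweight w m).+1)%N.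
  rewrite ltnS; apply: size_curve_poly => k.
  by rewrite msupp_sub_lead => /andP[]; apply: max_m.
rewrite -{1}sz_top in lt_rest.
rewrite size_polyDl // lead_coefDl // sz_top; split=> //.
by rewrite curve_polyZX lead_coefZ lead_coefXn mulr1.
Qed.

End Curve.

Lemma lead_coef_ge0 (R : rcfType) (f : {poly R}) :
  (forall x, 0 <= f.[x]) -> 0 <= lead_coef f.
Proof.
move=> f_ge0; rewrite leNgt; apply/negP => lc_lt0.
have [|x /(_ x (lexx x))] := @poly_pinfty_gt_lc _ (- f).
  by rewrite lead_coefN oppr_gt0.
rewrite lead_coefN hornerN lerN2 => /(le_trans (f_ge0 x)).
by rewrite leNgt lc_lt0.
Qed.

(** * Consequences of total stability *)

(** Testing at (1, ..., 1) gives c <= 0.  If all exponents are even, square roots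
    of - c and of the monomial are available; if the i-th one is odd, flipping
    the sign of the i-th coordinate gives c >= 0, hence c = 0. *)
Lemma nonpos_term_sqr (R : rcfType) (n : nat) (c : R) (m : 'X_{1..n}) :
  (forall s : 'I_n -> R, (forall i, s i != 0) -> c * 'X_[m].@[s] <= 0) ->
  exists r : {mpoly R[n]}, - (c *: 'X_[m]) = r ^+ 2.
Proof.
move=> le0.
have c_le0 : c <= 0.
  have := le0 (fun=> 1) (fun=> oner_neq0 _).
  by rewrite mevalX big1 ?mulr1 // => i _; rewrite expr1n.
have [/forallP ev|/forallPn[i odd_i]] := boolP [forall i, ~~ odd (m i)].
  exists (Num.sqrt (- c) *: 'X_[[multinom (m i)./2 | i < n]]).
  rewrite exprZn sqr_sqrtr ?oppr_ge0 // scaleNr; congr (- (_ *: _)).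
  rewrite mpolyXn; congr 'X_[_]; apply/mnmP => i.
  by rewrite mulmnE mnmE muln2 even_halfK.
have := le0 (fun j => if j == i then - 1 else 1).
rewrite mevalX (bigD1 i) //= eqxx big1 => [|j /negPf->]; last by rewrite expr1n.
rewrite -signr_odd (negPn odd_i) expr1 mulr1 mulrN1 oppr_le0 => c_ge0.
exists 0; suff -> : c = 0 by rewrite scale0r oppr0 expr0n.
apply/eqP; rewrite eq_le c_le0 c_ge0 // => j.
by case: ifP => _; rewrite ?oppr_eq0 oner_eq0.
Qed.

Lemma QM_sqr (A : comNzRingType) (f r : A) : QM [:: f] (r ^+ 2).
Proof.
exists (r ^+ 2), (fun=> 0); split; first by exists [:: r]; rewrite big_seq1.
  by exists [::]; rewrite big_nil.
by rewrite big1 ?addr0 // => i _; rewrite mul0r.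
Qed.

Lemma QM_gen (A : comNzRingType) (f : A) : QM [:: f] f.
Proof.
exists 0, (fun=> 1); split; first by exists [::]; rewrite big_nil.
  by exists [:: 1]; rewrite big_seq1 expr1n.
by rewrite big_ord1 mul1r add0r.
Qed.

Lemma zdeg_lt (n : nat) (R : nzRingType) (z : 'I_n -> int)
    (f : {mpoly R[n]}) (d : int) :
  (forall k, k \in msupp f -> zweight z k < d) -> (zdeg z f < d%:E)%E.
Proof.
move=> lt_d; rewrite /zdeg big_seq.
elim/big_ind: _ => [|a b lt_a lt_b|k /lt_d]; first exact: ltNyr.
  by rewrite gt_max lt_a.
by rewrite lte_fin.
Qed.

(** If the top term of [f] were non-positive, its opposite would be a square in
    QM(f); adding the element [f] to that square removes its only monomial,
    so the degree drops. *)
Lemma stable_top_term (R : rcfType) (n : nat) (w : 'I_n -> nat) m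
    (f : {mpoly R[n]}) :
  top_mon w m f -> totally_stable (fun i => (w i)%:Z) (QM [:: f]) ->
  ~ (forall s : 'I_n -> R, (forall i, s i != 0) -> f@_m * 'X_[m].@[s] <= 0).
Proof.
move=> [m_f max_m] stable /nonpos_term_sqr[r def_r].
have := stable _ _ (QM_sqr f r) (QM_gen f); rewrite -def_r addrC leNgt.
move/negP; apply.
have -> : zdeg (fun i => (w i)%:Z) (- (f@_m *: 'X_[m]))
  = ((nweight w m)%:Z)%:E%E.
  rewrite /zdeg (perm_big _ (msuppN _)) msuppMCX -?mcoeff_msupp //=.
  by rewrite big_seq1 zweightE.
apply: zdeg_lt => k; rewrite msupp_sub_lead => /andP[k_f neq_k].
by rewrite zweightE ltz_nat max_m.
Qed.

Unset Implicit Arguments.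

Theorem proposition4p3p2 (R : realType) (n : nat) (p q : {mpoly R[n.+1]})
  (ha : ~ in_principal_ideal (lex_lterm q) (lex_lterm p))
  (hb : forall z : 'I_n.+1 -> int, in_N1 z ->
     totally_stable z (QM [:: q]) /\ totally_stable z (QM [:: - p]))
  (hq : q <> 0) (hp : p <> 0) :
  ~ exists t : {mpoly R[n.+1]},
      nonneg_poly t /\ forall y : 'I_n.+1 -> R, 0 <= p.@[y] - t.@[y] * q.@[y].
Proof.
move=> [t [t_ge0 ptq_ge0]].
(* B exceeds every exponent of p and every sum of an exponent of q and one of
   t, so the weight separates the monomials of p from those of t * q. *)
pose B := (msize p + msize q + msize t).+1.
pose w := @digit_weight B n.
have [stable_q stable_p] := hb _ (@digit_weight_N1 B n isT).
have top_p : top_mon w (lex_mlead p) p by apply: top_mon_lex; [apply/eqP|lia].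
have top_q : top_mon w (lex_mlead q) q by apply: top_mon_lex; [apply/eqP|lia].
have not_p := stable_top_term (top_monN top_p) stable_p.
have not_q := stable_top_term top_q stable_q.
have curve_ge0 s : 0 <= lead_coef
    (curve_poly w s p - curve_poly w s t * curve_poly w s q).
  apply: lead_coef_ge0 => x.
  by rewrite hornerD hornerN hornerM !horner_curve_poly.
have p_dominates : ~ forall s : 'I_n.+1 -> R, (forall i, s i != 0) ->
    (size (curve_poly w s t * curve_poly w s q)%R < size (curve_poly w s p))%N.
  move=> lt_tq; apply: not_p => s s_neq0; have := curve_ge0 s.
  rewrite lead_coefDl ?size_polyN ?lt_tq //.
  by rewrite (curve_poly_top top_p s_neq0).2 mcoeffN mulNr oppr_le0.
have [t0|t_neq0] := eqVneq t 0.
  apply: p_dominates => s s_neq0.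
  rewrite t0 {1}/curve_poly raddf0 mul0r size_poly0.
  by rewrite (curve_poly_top top_p s_neq0).1.
have top_t : top_mon w (lex_mlead t) t by apply: top_mon_lex; [|lia].
have size_tq s : (forall i, s i != 0) ->
    size (curve_poly w s t * curve_poly w s q)
    = (nweight w (lex_mlead t) + nweight w (lex_mlead q)).+1.
  move=> s_neq0; have [sz_t _] := curve_poly_top top_t s_neq0.
  have [sz_q _] := curve_poly_top top_q s_neq0.
  by rewrite size_mul -?size_poly_gt0 ?sz_t ?sz_q // addnS.
case: (ltngtP (nweight w (lex_mlead t) + nweight w (lex_mlead q))%N
              (nweight w (lex_mlead p))) => [lt_tq|lt_p|eq_tq].
- apply: p_dominates => s s_neq0.
  by rewrite size_tq // (curve_poly_top top_p s_neq0).1.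
- apply: not_q => s s_neq0.
  have [_ lc_t] := curve_poly_top top_t s_neq0.
  have [_ lc_q] := curve_poly_top top_q s_neq0.
  have t_gt0 : 0 < t@_(lex_mlead t) * 'X_[lex_mlead t].@[s].
    rewrite -lc_t lt_def lead_coef_eq0 -size_poly_gt0.
    rewrite (curve_poly_top top_t s_neq0).1 /=.
    by apply: lead_coef_ge0 => x; rewrite horner_curve_poly t_ge0.
  have := curve_ge0 s.
  rewrite addrC lead_coefDl; last first.
    by rewrite size_polyN size_tq // (curve_poly_top top_p s_neq0).1.
  by rewrite lead_coefN lead_coefM lc_t lc_q oppr_ge0 pmulr_rle0.
- apply: ha.
  have lead_p : lex_mlead p = (lex_mlead q + lex_mlead t)%MM.
    apply: (@digit_weight_inj B) => [i|i|].
    + have := mnm_lt_msize i top_p.1; lia.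
    + have := mnm_lt_msize i top_q.1; have := mnm_lt_msize i top_t.1.
      rewrite mnmDE; lia.
    + by rewrite nweightD addnC.
  exists ((p@_(lex_mlead p) / q@_(lex_mlead q)) *: 'X_[lex_mlead t]).
  rewrite /lex_lterm {2}lead_p mpolyXD -scalerAl -scalerAr scalerA; congr (_ *: _).
  by rewrite mulrCA mulfV ?mulr1 // -mcoeff_msupp top_q.1.
Qed.
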